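(* Let $\delta\in(0,n)$ and $p\in[1,\infty)$. Then $\mathcal A_{p,\delta}\subsetneqq\mathcal A_{p,n}$, and $\mathcal A_{p,n}$ coincides with the classical Muckenhoupt class $A_p$ when restricted to Lebesgue measurable weights, i.e. a Lebesgue measurable function $w$ belongs to $\mathcal A_{p,n}$ if and only if $w\in A_p$.
   Context: All weights are non-negative functions on $\mathbb R^n$. A cube $Q\subset\mathbb R^n$ is a left-open right-closed cube with sides parallel to the axes; $l(Q)$ is its edge length. For $\delta\in(0,n]$ and $E\subset\mathbb R^n$, the Hausdorff content is $\mathcal H^\delta_\infty(E):=\inf\{\sum_i l(Q_i)^\delta:\ E\subset\bigcup_i Q_i\}$, the infimum over all finite or countable coverings of $E$ by cubes. For $E\subset\mathbb R^n$ and a non-negative function $g$ (no measurability required) the Choquet integral is $\int_E g\,d\mathcal H^\delta_\infty:=\int_0^\infty \mathcal H^\delta_\infty(\{x\in E: g(x)>t\})\,dt$. ''Almost everywhere'' with respect to $\mathcal H^\delta_\infty$ means outside a set of zero $\mathcal H^\delta_\infty$-content. An $\mathcal H^\delta_\infty$-capacitary weight is a non-negative function $w$ with $\int_E w\,d\mathcal H^\delta_\infty<\infty$ for all compact $E$ and $w\in(0,\infty)$ $\mathcal H^\delta_\infty$-almost everywhere. For $p\in(1,\infty)$, $w\in\mathcal A_{p,\delta}$ means $w$ is an $\mathcal H^\delta_\infty$-capacitary weight with $[w]_{\mathcal A_{p,\delta}}:=\sup_Q\{\frac1{\mathcal H^\delta_\infty(Q)}\int_Qw\,d\mathcal H^\delta_\infty\}\{\frac1{\mathcal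 H^\delta_\infty(Q)}\int_Qw^{-\frac1{p-1}}d\mathcal H^\delta_\infty\}^{p-1}<\infty$ (supremum over all cubes). $w\in\mathcal A_{1,\delta}$ means $w$ is an $\mathcal H^\delta_\infty$-capacitary weight with $\mathcal M_{\mathcal H^\delta_\infty}w\le Kw$ $\mathcal H^\delta_\infty$-a.e. for some $K\in(0,\infty)$, where $\mathcal M_{\mathcal H^\delta_\infty}f(x):=\sup_{Q\ni x}\frac1{\mathcal H^\delta_\infty(Q)}\int_Q|f|\,d\mathcal H^\delta_\infty$, the supremum over all cubes containing $x$. The classical class $A_p$ consists of the $w\in L^1_{\rm loc}(\mathbb R^n)$ with $w\in(0,\infty)$ Lebesgue-a.e. such that, for $p\in(1,\infty)$, $\sup_Q[\frac1{|Q|}\int_Qw\,dx][\frac1{|Q|}\int_Qw^{-\frac1{p-1}}dx]^{p-1}<\infty$, and, for $p=1$, $\operatorname{ess\,sup}_{x}\frac{\mathcal Mw(x)}{w(x)}<\infty$ with $\mathcal M$ the classical Hardy-Littlewood maximal operator $\mathcal Mf(x)=\sup_{Q\ni x}\frac1{|Q|}\int_Q|f|\,dy$. *)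

(* Defs.v *)
From HB Require Import structures.
From mathcomp Require Import all_boot all_order all_algebra.
From mathcomp Require Import all_classical all_reals all_analysis.
From mathcomp Require Import measurable_realfun ess_sup_inf.

Set Implicit Arguments.
Unset Strict Implicit.
Unset Printing Implicit Defensive.

Import Order.TTheory GRing.Theory Num.Theory.
Import numFieldNormedType.Exports.

Local Open Scope classical_set_scope.
Local Open Scope ring_scope.
Local Open Scope ereal_scope.

Section cover_content.
Context {R : realType} {T I : Type}.
Variables (S : I -> set T) (c : I -> R).

(* The infimum of the costs of the finite or countable coverings of E by sets
   S i; finiteness or countability is carried by the index set D. *)
Definition cover_content (E : set T) : \bar R :=
  ereal_inf [set x | exists (D : set nat) (F : nat -> I),
    E `<=` \bigcup_(k in D) S (F k) /\ x = \esum_(k in D) (c (F k))%:E].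

Lemma le_cover_content : {homo cover_content : A B / A `<=` B >-> A <= B}.
Proof.
move=> A B AB; apply/ereal_inf_le_tmp => x [D [F [BF ->]]].
by exists D, F; split => //; exact: subset_trans BF.
Qed.

Hypothesis c_ge0 : forall i, (0 <= c i)%R.

Lemma cover_content_ge0 A : 0 <= cover_content A.
Proof.
apply: le_ereal_inf_tmp => x [D [F [_ ->]]].
by apply: esum_ge0 => k _; rewrite lee_fin.
Qed.

Lemma cover_content0 (i0 : I) : cover_content set0 = 0.
Proof.
apply/eqP; rewrite eq_le cover_content_ge0 andbT.
apply: ereal_inf_lbound; exists set0, (fun=> i0).
by split; [exact: sub0set | rewrite esum_set0].
Qed.

Lemma cover_content_sigma_subadditive : sigma_subadditive cover_content.
Proof.
move=> A; have [[i ioo]|] := pselect (exists i, cover_content (A i) = +oo).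
  rewrite (eseries_pinfty _ _ ioo) ?leey// => n _.
  by rewrite -ltNye (lt_le_trans _ (cover_content_ge0 _)).
rewrite -forallNE => Aoo.
suff add2e (e : {posnum R}) : cover_content (\bigcup_n A n) <=
    \sum_(i <oo) cover_content (A i) + e%:num%:E.
  by apply/lee_addgt0Pr => _/posnumP[].
apply: le_trans (epsilon_trick _ _ _) => //; last first.
  by move=> n; exact: cover_content_ge0.
pose P n (DF : set nat * (nat -> I)) :=
  A n `<=` \bigcup_(k in DF.1) S (DF.2 k) /\
  \esum_(k in DF.1) (c (DF.2 k))%:E <=
    cover_content (A n) + (e%:num / (2 ^ n.+1)%:R)%:E.
have [G PG] : {G : nat -> set nat * (nat -> I) & forall n, P n (G n)}.
  apply: (@choice _ _ P) => n; rewrite /P.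
  have Afin : cover_content (A n) \is a fin_num.
    by rewrite ge0_fin_numE ?cover_content_ge0// ltey; exact/eqP/Aoo.
  have en1 : (0 < e%:num / (2 ^ n.+1)%:R)%R by [].
  have [x [D [F [AF xE]]] xlt] := lb_ereal_inf_adherent en1 Afin.
  by exists (D, F); split => //=; rewrite -xE; exact: ltW.
rewrite nneseries_esumT; last first.
  move=> n; apply: adde_ge0; first exact: cover_content_ge0.
  by rewrite lee_fin divr_ge0.
apply: (@le_trans _ _
    (\esum_(i in setT) \esum_(k in (G i).1) (c ((G i).2 k))%:E)); last first.
  by apply: le_esum => i _; exact: (PG i).2.
rewrite (@esum_esum _ _ _ setT (fun i => (G i).1)
  (fun i k => (c ((G i).2 k))%:E)); last by move=> *; rewrite lee_fin.
have /card_esym/ppcard_eqP[f] := card_nat2.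
pose J : set (nat * nat) := setT `*`` (fun i => (G i).1).
have fbij : set_bij (f @^-1` J) J f.
  split; first by move=> x.
  - by move=> x y _ _; apply: (@inj _ _ setT f); rewrite inE.
  - by move=> y Jy; exists (f^-1%FUN y); rewrite /= ?invK ?inE.
apply: ereal_inf_lbound => /=.
exists (f @^-1` J), (fun k => (G (f k).1).2 (f k).2); split.
  move=> t [i _ /(PG i).1 [j Dj Sj]].
  by exists (f^-1%FUN (i, j)) => /=; rewrite invK ?inE.
by rewrite (reindex_esum _ _ _ _ fbij).
Qed.

End cover_content.

Section cubes.
Context {R : realType} {n : nat}.

(* Q is the product of the left-open right-closed ]Q.1_i, Q.1_i + edge Q]. *)
Definition cube : Type := ('rV[R]_n * {posnum R})%type.

Definition edge (Q : cube) : R := Q.2%:num.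

Definition cube_set (Q : cube) : set 'rV[R]_n :=
  [set x | forall i, (Q.1 ord0 i < x ord0 i <= Q.1 ord0 i + edge Q)%R].

Definition hausdorff_content (delta : R) : set 'rV[R]_n -> \bar R :=
  cover_content cube_set (fun Q => edge Q `^ delta)%R.

Definition choquet_integral (delta : R) (E : set 'rV[R]_n)
    (g : 'rV[R]_n -> \bar R) : \bar R :=
  \int[lebesgue_measure]_(t in `]0%R, +oo[)
    hausdorff_content delta (E `&` [set x | t%:E < g x]).

Definition content_ae (delta : R) (P : 'rV[R]_n -> Prop) : Prop :=
  exists2 N : set 'rV[R]_n, hausdorff_content delta N = 0 &
    forall x, ~ N x -> P x.

Definition capacitary_weight (delta : R) (w : 'rV[R]_n -> \bar R) : Prop :=
  [/\ forall x, 0 <= w x,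
      forall E, compact E -> choquet_integral delta E w < +oo &
      content_ae delta (fun x => 0 < w x < +oo)].

(* w ^ (- 1 / (p - 1)), equal to +oo where w = 0 and to 0 where w = +oo; the
   library powers with a negative exponent would give 0 where w = 0. *)
Definition dual_weight (p : R) (w : 'rV[R]_n -> \bar R) (x : 'rV[R]_n) :
  \bar R := (w x `^ (p - 1)^-1)^-1.

Definition capacitary_average (delta : R) (Q : cube)
    (f : 'rV[R]_n -> \bar R) : \bar R :=
  choquet_integral delta (cube_set Q) f / hausdorff_content delta (cube_set Q).

Definition capacitary_maximal (delta : R) (f : 'rV[R]_n -> \bar R)
    (x : 'rV[R]_n) : \bar R :=
  ereal_sup [set capacitary_average delta Q (fun y => `|f y|) |
             Q in [set Q | cube_set Q x]].

Definition capacitary_Ap_const (delta p : R) (w : 'rV[R]_n -> \bar R) :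
    \bar R :=
  ereal_sup [set capacitary_average delta Q w *
                 capacitary_average delta Q (dual_weight p w) `^ (p - 1) |
             Q in [set: cube]].

(* Meaningful for 1 <= p. *)
Definition capacitary_Ap (delta p : R) : set ('rV[R]_n -> \bar R) :=
  [set w | capacitary_weight delta w /\
    if p == 1%R then
      exists2 K : R, (0 < K)%R &
        content_ae delta (fun x => capacitary_maximal delta w x <= K%:E * w x)
    else capacitary_Ap_const delta p w < +oo].

End cubes.
Arguments cube : clear implicits.

Section lebesgue_rV.
Context (R : realType) (n : nat).

(* The product of the intervals ]B.1_i, B.2_i]; it is empty, and of volume 0,
   as soon as B.2_i <= B.1_i for some i. *)
Definition box (B : 'rV[R]_n * 'rV[R]_n) : set 'rV[R]_n :=
  [set x | forall i, (B.1 ord0 i < x ord0 i <= B.2 ord0 i)%R].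

Definition box_volume (B : 'rV[R]_n * 'rV[R]_n) : R :=
  (\prod_(i < n) Num.max 0 (B.2 ord0 i - B.1 ord0 i))%R.

Lemma box_volume_ge0 B : (0 <= box_volume B)%R.
Proof. by apply: prodr_ge0 => i _; rewrite le_max lexx. Qed.

Definition lebesgue_outer : set 'rV[R]_n -> \bar R :=
  cover_content box box_volume.

HB.instance Definition _ := isOuterMeasure.Build R 'rV[R]_n lebesgue_outer
  (cover_content0 box box_volume_ge0 (0, 0)%R)
  (cover_content_ge0 box box_volume_ge0)
  (le_cover_content box box_volume)
  (cover_content_sigma_subadditive box box_volume_ge0).

(* R^n with the Lebesgue measurable sets, i.e., the Caratheodory measurable
   sets of the Lebesgue outer measure (not just the Borel sets). *)
Definition lebesgue_rV := caratheodory_type lebesgue_outer.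
HB.instance Definition _ := Measurable.on lebesgue_rV.

Definition lebesgue_measure_rV : set lebesgue_rV -> \bar R := lebesgue_outer.

Let measure_rV0 : lebesgue_measure_rV set0 = 0.
Proof. exact: (outer_measure0 lebesgue_outer). Qed.

Let measure_rV_ge0 A : 0 <= lebesgue_measure_rV A.
Proof. exact: (outer_measure_ge0 lebesgue_outer). Qed.

Let measure_rV_semi_sigma_additive : semi_sigma_additive lebesgue_measure_rV.
Proof. exact: (@caratheodory_measure_sigma_additive _ _ lebesgue_outer). Qed.

HB.instance Definition _ := isMeasure.Build _ _ _ lebesgue_measure_rV
  measure_rV0 measure_rV_ge0 measure_rV_semi_sigma_additive.

End lebesgue_rV.

Section muckenhoupt.
Context {R : realType} {n : nat}.
Local Notation mu := (@lebesgue_measure_rV R n).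

Definition average (Q : cube R n) (f : 'rV[R]_n -> \bar R) : \bar R :=
  (\int[mu]_(x in cube_set Q) f x) / mu (cube_set Q).

Definition hardy_littlewood (f : 'rV[R]_n -> \bar R) (x : 'rV[R]_n) : \bar R :=
  ereal_sup [set average Q (fun y => `|f y|) | Q in [set Q | cube_set Q x]].

Definition lebesgue_measurable (f : 'rV[R]_n -> \bar R) : Prop :=
  measurable_fun [set: lebesgue_rV R n] (f : lebesgue_rV R n -> \bar R).

Definition L1loc (f : 'rV[R]_n -> \bar R) : Prop :=
  lebesgue_measurable f /\
  forall E : set 'rV[R]_n, compact E -> \int[mu]_(x in E) `|f x| < +oo.

Definition muckenhoupt_Ap_const (p : R) (w : 'rV[R]_n -> \bar R) : \bar R :=
  ereal_sup [set average Q w * average Q (dual_weight p w) `^ (p - 1) |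
             Q in [set: cube R n]].

(* Meaningful for 1 <= p. *)
Definition muckenhoupt_Ap (p : R) : set ('rV[R]_n -> \bar R) :=
  [set w | [/\ forall x, 0 <= w x,
      L1loc w,
      {ae mu, forall x, 0 < w x < +oo} &
      if p == 1%R then ess_sup mu (fun x => hardy_littlewood w x / w x) < +oo
      else muckenhoupt_Ap_const p w < +oo]].

End muckenhoupt.

(* Main.v *)
From HB Require Import structures.
Require Import Defs.
From mathcomp Require Import all_boot all_order all_algebra.
From mathcomp Require Import all_classical all_reals all_analysis.
From mathcomp Require Import measurable_realfun ess_sup_inf.
From mathcomp Require Import ring lra.
Import Order.TTheory GRing.Theory Num.Theory.
Import numFieldNormedType.Exports.

(** Three facts carry the proof.

    Smaller exponents give larger averages.  If E lies in a cube Q of edge l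
    and d1 <= d2, a cover of E by cubes of edges l_i either contains a cube
    with l <= l_i, or satisfies (l_i / l)^d2 <= (l_i / l)^d1 throughout; in
    both cases H^d2(E) / l^d2 <= H^d1(E) / l^d1
    ([hausdorff_content_mono_exponent]).  For 0 <= d <= n the content of Q is
    exactly l^d, so after integration in the level t the normalized average of
    any non-negative function over Q does not increase with the exponent.
    Maximal functions, A_p constants and null sets follow, which yields the
    inclusion of the classes ([capacitary_Ap_exponent]).

    For d = n the content is the Lebesgue outer measure
    ([hausdorff_content_lebesgue]): a box of sides L_i is covered by a grid of
    cubes of edge h of total volume at most the product of the L_i + h, and h
    tends to 0.  The Choquet integral of a measurable function is then its
    Lebesgue integral by the layer-cake formula, so both definitions of A_p
    agree on measurable weights ([capacitary_Ap_lebesgue]).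

    The inclusion is strict because of the weight |x|^-a, delta < a < n, with
    the sup norm.  For the exponent n its average over a cube is at most a
    constant times its infimum over that cube, which implies every A_p
    condition ([power_weight_Ap]).  For the exponent delta it is not even
    locally integrable: the set where it exceeds t is, up to constants, a cube
    of edge t^(-1/a), of content t^(-delta/a), which is not integrable at
    infinity ([power_weight_notin_Ap]).

    Everything rests on the fact that the outer measure of a box is its
    volume ([lebesgue_outer_box]). *)

Set Implicit Arguments.
Unset Strict Implicit.
Unset Printing Implicit Defensive.

Local Open Scope classical_set_scope.
Local Open Scope ring_scope.

(** * Auxiliary facts on integration *)

(** The integral of a non-negative function is a supremum over the simple
    functions below it, hence monotone among arbitrary functions, such as
    weights and their distribution functions. *)
Lemma nonneg_le_integral d (T : measurableType d) (R : realType)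
    (mu : {measure set T -> \bar R}) (D : set T) (f g : T -> \bar R) :
  (forall x, D x -> 0 <= f x)%E -> (forall x, D x -> f x <= g x)%E ->
  (\int[mu]_(x in D) f x <= \int[mu]_(x in D) g x)%E.
Proof.
move=> f0 fg; rewrite !ge0_integralE//; last first.
  by move=> x Dx; exact: le_trans (f0 x Dx) (fg x Dx).
apply: ereal_sup_le => _ [h hf <-]; exists h => // x.
by apply: le_trans (hf x) _; rewrite /patch; case: ifPn => // /set_mem /fg.
Qed.

Section measurability.
Local Open Scope ereal_scope.

(** On non-negative extended reals inversion is an order-reversing involution,
    so the superlevel sets of 1 / f are sublevel sets of f. *)
Lemma measurable_fun_inve d (T : measurableType d) (R : realType)
    (f : T -> \bar R) : (forall x, 0 <= f x) ->
  measurable_fun [set: T] f -> measurable_fun [set: T] (fun x => (f x)^-1).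
Proof.
move=> f0 mf mT; apply: (measurability _ (ErealGenOInfty.measurableE R)) => //.
move=> _ [_ [r ->] <-]; rewrite setTI preimage_itvoy.
have [r0|r0] := ltP r 0%R.
  rewrite (_ : [set x | _] = setT) //.
  apply/seteqP; split => // x _ /=.
  by apply: (@lt_le_trans _ _ 0); rewrite ?lte_fin ?inve_ge0.
have -> : [set x | r%:E < (f x)^-1] = [set x | f x < r%:E^-1].
  by apply/seteqP; split => x /=; rewrite inve_pgt// ?inE ?lee_fin.
rewrite -[X in measurable X]setTI; exact: emeasurable_fun_infty_o.
Qed.

(** Distribution functions t |-> H (E `&` [set x | t < f x]) are measurable for
    this reason alone, whatever f is. *)
Lemma nonincreasing_emeasurable (R : realType) (f : R -> \bar R) (D : set R) :
  {homo f : s t / (s <= t)%R >-> t <= s} -> measurable_fun D f.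
Proof.
move=> fdec mD; apply: (measurability _ (ErealGenOInfty.measurableE R)) => //.
move=> _ [_ [r ->] <-]; rewrite preimage_itvoy; apply: measurableI => //.
apply: is_interval_measurable => s t /= rs rt u /andP[su ut].
exact: lt_le_trans rt (fdec _ _ ut).
Qed.

(** The classical A_1 condition in the form used for capacities.  The
    essential supremum itself need not be a positive K: it can be 0, and it is
    -oo when the measure vanishes. *)
Lemma ess_sup_ratio_ltyP d (T : measurableType d) (R : realType)
    (mu : {measure set T -> \bar R}) (M w : T -> \bar R) :
  {ae mu, forall x, 0 < w x < +oo} ->
  (ess_sup mu (fun x => M x / w x) < +oo) <->
  exists2 K : R, (0 < K)%R & {ae mu, forall x, M x <= K%:E * w x}.
Proof.
move=> w0.
have ratioP K x : 0 < w x < +oo ->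
    (M x / w x <= K%:E) = (M x <= K%:E * w x).
  case: (w x) => [r /andP[+ _]|/andP[]//|//].
  by rewrite lte_fin => r0; rewrite inver gt_eqF// lee_pdivrMr.
split=> [Moo|[K K0 MK]].
  pose s := ess_sup mu (fun x => M x / w x).
  exists (Num.max 1 (fine s))%R; first by rewrite lt_max ltr01.
  have sK : s <= (Num.max 1 (fine s))%:E.
    move: Moo; rewrite -/s; case: s => [r _|//|_]; last by rewrite leNye.
    by rewrite lee_fin le_max lexx orbT.
  have := ess_sup_ge mu (fun x => M x / w x); rewrite -/s.
  move=> Ms; near=> x; rewrite -ratioP.
    by apply: le_trans sK; near: x.
  by near: x.
apply: (@le_lt_trans _ _ K%:E); last exact: ltry.
apply/ess_supP; near=> x; rewrite ratioP; first by near: x.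
by near: x.
Unshelve. all: by end_near. Qed.

End measurability.

Section layer_cake.
Context d (T : measurableType d) (R : realType).
Variable mu : {sigma_finite_measure set T -> \bar R}.

(** Tonelli for the region under the graph: its vertical section at x is an
    interval of length f x, its horizontal section at t is the superlevel
    set. *)
Lemma layer_cake (E : set T) (f : T -> \bar R) : measurable E ->
  measurable_fun [set: T] f -> (forall x, 0 <= f x)%E ->
  (\int[mu]_(x in E) f x =
   \int[lebesgue_measure]_(t in `]0%R, +oo[) mu (E `&` [set x | t%:E < f x]))%E.
Proof.
move=> mE mf f0.
pose leb : {sigma_finite_measure set (measurableTypeR R) -> \bar R} :=
  @lebesgue_measure R.
pose S : set (T * measurableTypeR R) :=
  [set xt | [/\ E xt.1, 0 < xt.2 & (xt.2%:E < f xt.1)%E]].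
have mS : measurable S.
  have mpos : measurable (`]0, +oo[ : set (measurableTypeR R)) by [].
  have mlt : measurable [set xt : T * measurableTypeR R | (xt.2%:E < f xt.1)%E].
    have mg : measurable_fun [set: T * measurableTypeR R]
        (fun xt => f xt.1 - (xt.2 : R)%:E)%E.
      apply: emeasurable_funB; first exact: measurableT_comp mf measurable_fst.
      by apply/measurable_EFinP; exact: measurable_snd.
    have := emeasurable_fun_o_infty measurableT mg 0%E.
    rewrite setTI; congr measurable; apply/seteqP; split => -[x t] /=;
      by rewrite -(sube_gt0 (t : R)%:E).
  rewrite (_ : S = (E `*` `]0, +oo[) `&`
     [set xt : T * measurableTypeR R | (xt.2%:E < f xt.1)%E]); last first.
    apply/seteqP; split => -[x t] /=.
      by case=> Ex t0 tf; rewrite in_itv/= andbT.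
    by case=> -[Ex]; rewrite in_itv/= andbT.
  by apply: measurableI => //; exact: measurableX.
have := indic_fubini_tonelli mu leb mS.
rewrite indic_fubini_tonelli_FE// indic_fubini_tonelli_GE//.
move=> main; rewrite [in RHS]integral_mkcond [in LHS]integral_mkcond.
transitivity (\int[mu]_x leb (xsection S x))%E; last first.
  rewrite main; apply: eq_integral => t _ /=.
  rewrite patchE; case: ifPn => [|/negP] t0.
    move: t0; rewrite inE/= in_itv/= andbT => t0; congr (mu _).
    by apply/seteqP; split => x; rewrite /ysection/= inE /S/=; [case|case].
  rewrite (_ : ysection S t = set0) ?measure0//.
  apply/seteqP; split => // x; rewrite /ysection/= inE /S/= => -[_ t1 _]; apply: t0.
  by rewrite inE/= in_itv/= t1.
apply: eq_integral => x _; rewrite patchE; case: ifPn => [/set_mem Ex|/negP xE].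
  have -> : xsection S x = [set t | 0 < t /\ (t%:E < f x)%E].
    by apply/seteqP; split => t; rewrite /xsection/= inE /S/=; [case|case].
  rewrite /leb/=; case fx: (f x) => [r| |].
  - rewrite (_ : [set t | _] = `]0, r[%classic); last first.
      by apply/seteqP; split => t /=; rewrite in_itv/= lte_fin;
        [move=> [-> ->]|move=> /andP[]].
    rewrite lebesgue_measure_itv/= lte_fin; case: ltP; rewrite ?sube0// => r0.
    by apply/eqP; rewrite eq_le -{2}fx f0 lee_fin r0.
  - rewrite (_ : [set t | _] = `]0, +oo[%classic).
      by rewrite lebesgue_measure_itv/= ltry.
    by apply/seteqP; split => t /=; rewrite in_itv/= andbT ltry //; case.
  - by have := f0 x; rewrite fx.
have -> : xsection S x = set0; last by rewrite [RHS]measure0.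
by apply/seteqP; split => // t; rewrite /xsection/= inE /S/= => -[/mem_set].
Qed.

End layer_cake.

(** * The outer measure of a box is its volume *)

Section box_cover.
Context {R : realType} {n : nat}.
Implicit Types (x : 'I_n -> R) (B : 'rV[R]_n * 'rV[R]_n).

(** The indicator function of the box B in which the coordinates below j have
    been integrated out: it interpolates between the indicator (j = 0) and the
    volume (j = n). *)
Definition partial_volume (j : nat) x B : R :=
  \prod_(i < n) if (i < j)%N then Num.max 0 (B.2 ord0 i - B.1 ord0 i)
                else \1_`]B.1 ord0 i, B.2 ord0 i] (x i).

Lemma partial_volume_ge0 j x B : 0 <= partial_volume j x B.
Proof. by apply: prodr_ge0 => i _; case: ifP => _; rewrite ?le_max ?lexx. Qed.

Lemma partial_volume0 x B : partial_volume 0 x B = \1_(box B) (\row_i x i).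
Proof.
rewrite /partial_volume indicE; have [xB|xB] := boolP (_ \in box B).
  apply: big1 => i _ /=; rewrite indicE mem_set//=.
  by move: xB; rewrite inE => /(_ i); rewrite mxE in_itv/=.
have [i xi] : exists i, ~ (B.1 ord0 i < x i <= B.2 ord0 i).
  apply: contrapT => /forallNP h; move/negP : xB; apply; rewrite inE => i.
  by rewrite mxE; exact: contrapT (h i).
rewrite (bigD1 i)//= indicE memNset ?mul0r//= in_itv/=.
Qed.

Lemma partial_volume_full x B : partial_volume n x B = box_volume B.
Proof. by apply: eq_bigr => i _; rewrite ltn_ord. Qed.

Lemma integral_partial_volume (j : 'I_n) x B :
  (\int[lebesgue_measure]_s
     (partial_volume j (fun i => if i == j then s else x i) B)%:E =
   (partial_volume j.+1 x B)%:E)%E.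
Proof.
pose c := \prod_(i < n | i != j)
   if (i < j)%N then Num.max 0 (B.2 ord0 i - B.1 ord0 i)
                else \1_`]B.1 ord0 i, B.2 ord0 i] (x i).
have c0 : 0 <= c by apply: prodr_ge0 => i _; case: ifP => _; rewrite ?le_max ?lexx.
transitivity (\int[lebesgue_measure]_s
     (c%:E * (\1_`]B.1 ord0 j, B.2 ord0 j] (s : R))%:E))%E.
  apply: eq_integral => s _; rewrite -EFinM /partial_volume (bigD1 j)//= ltnn eqxx.
  rewrite mulrC; congr (_ * _)%:E; apply: eq_bigr => i /negbTE ->.
  by case: ifP.
rewrite ge0_integralZl_EFin//=; last first.
  by apply/measurable_EFinP; exact: measurable_indic.
rewrite integral_indic//= setIT lebesgue_measure_itv/= lte_fin.
rewrite /partial_volume (bigD1 j)//= ltnSn mulrC EFinM; congr (_ * _)%E.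
  rewrite /c; congr EFin; apply: eq_bigr => i ij.
  suff -> : (i < j.+1)%N = (i < j)%N by [].
  by rewrite ltnS leq_eqVlt -[(_ == _ :> nat)]/(i == j) (negbTE ij).
case: ltP => h; congr EFin; first by rewrite max_r// subr_ge0 ltW.
by rewrite max_l// subr_le0.
Qed.

Lemma measurable_partial_volume (j : 'I_n) x B : measurable_fun [set: R]
   (fun s => partial_volume j (fun i => if i == j then s else x i) B).
Proof.
apply: measurable_prod => i _; case: (i < j)%N; first exact: measurable_cst.
case: (i == j); first exact: measurable_indic.
exact: measurable_cst.
Qed.

(** The indicator of B is at most the sum of the indicators of the boxes that
    cover it.  Integrating this inequality in one coordinate after the other
    turns indicators into volumes; the countable sum passes through each
    one-dimensional integral by monotone convergence. *)
Lemma box_volume_le_cover (B : 'rV[R]_n * 'rV[R]_n) (D : set nat)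
    (F : nat -> 'rV[R]_n * 'rV[R]_n) :
  box B `<=` \bigcup_(k in D) box (F k) ->
  ((box_volume B)%:E <= \esum_(k in D) (box_volume (F k))%:E)%E.
Proof.
move=> BF.
(* Weights 0 and 1 encode D, so that the sum is over all of nat. *)
pose m k : R := (k \in D)%:R.
have main (j : nat) x : (j <= n)%N ->
  ((partial_volume j x B)%:E <= \sum_(k <oo) (m k * partial_volume j x (F k))%:E)%E.
  elim: j x => [|j IH] x jn.
    rewrite partial_volume0 indicE; have [xB|xB] := boolP (_ \in _); last first.
      by apply: nneseries_ge0 => k _ _; rewrite lee_fin mulr_ge0// partial_volume_ge0.
    move: xB; rewrite inE => /BF[k Dk Fk].
    rewrite (@nneseriesD1 _ _ k)//; last first.
      by move=> i _; rewrite lee_fin mulr_ge0// partial_volume_ge0.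
    rewrite partial_volume0 indicE mem_set// /m mem_set// mulr1 leeDl//.
    by apply: nneseries_ge0 => i _ _; rewrite lee_fin mulr_ge0// partial_volume_ge0.
  pose J := Ordinal jn.
  rewrite -(integral_partial_volume J).
  apply: (@le_trans _ _ (\int[lebesgue_measure]_s \sum_(k <oo)
   (m k * partial_volume j (fun i => if i == J then s else x i) (F k))%:E)%E).
    apply: nonneg_le_integral => s _; first by rewrite lee_fin partial_volume_ge0.
    by apply: IH; exact: ltnW.
  rewrite integral_nneseries//=; last 2 first.
  - move=> k; apply/measurable_EFinP; apply: measurable_funM => //.
    exact: measurable_partial_volume.
  - by move=> k s _; rewrite lee_fin mulr_ge0// partial_volume_ge0.
  apply: lee_nneseries => [k _ _|k _].
    by apply: integral_ge0 => s _; rewrite lee_fin mulr_ge0// partial_volume_ge0.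
  under eq_integral do rewrite EFinM.
  rewrite ge0_integralZl_EFin//; last 2 first.
  - by move=> s _; rewrite lee_fin partial_volume_ge0.
  - by apply/measurable_EFinP; exact: measurable_partial_volume.
  by rewrite (integral_partial_volume J) -EFinM.
have := main n (fun=> 0) (leqnn n).
rewrite partial_volume_full => /le_trans; apply.
rewrite nneseries_esumT; last first.
  by move=> k; rewrite lee_fin mulr_ge0// partial_volume_ge0.
rewrite [leRHS]esum_mkcond le_esum// => k _.
rewrite partial_volume_full /m; case: ifP => _; first by rewrite mul1r.
by rewrite mul0r.
Qed.

Lemma lebesgue_outer_box B : lebesgue_outer (box B) = (box_volume B)%:E.
Proof.
apply/eqP; rewrite eq_le; apply/andP; split.
  apply: ereal_inf_lbound; exists [set 0%N], (fun=> B); split.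
    by move=> x Bx; exists 0%N.
  by rewrite esum_set1// lee_fin box_volume_ge0.
by apply: le_ereal_inf_tmp => _ [D [F [BF ->]]]; exact: box_volume_le_cover.
Qed.

End box_cover.

(** * Hausdorff contents *)

Section edge.
Context {R : realType} {n : nat}.
Implicit Types (d r s : R) (Q : cube R n).

Lemma edge_gt0 Q : 0 < edge Q. Proof. by rewrite /edge. Qed.

Lemma edge_ge0 Q : 0 <= edge Q. Proof. exact: ltW (edge_gt0 Q). Qed.

Lemma edge_powR_ge0 d Q : 0 <= edge Q `^ d. Proof. exact: powR_ge0. Qed.

Lemma edge_powRD r s Q : edge Q `^ (r + s) = edge Q `^ r * edge Q `^ s.
Proof.
by rewrite powRD//; apply/implyP => _; rewrite gt_eqF// edge_gt0.
Qed.

End edge.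

#[local] Hint Resolve edge_gt0 edge_ge0 : core.

Section hausdorff_content.
Context {R : realType} {n : nat}.
Implicit Types (d : R) (Q : cube R n) (E : set 'rV[R]_n).
Local Notation H := (@hausdorff_content R n).

HB.instance Definition _ d := isOuterMeasure.Build R 'rV[R]_n
  (@hausdorff_content R n d)
  (cover_content0 cube_set (edge_powR_ge0 d) (0, 1%:pos))
  (cover_content_ge0 cube_set (edge_powR_ge0 d))
  (le_cover_content cube_set (fun Q => edge Q `^ d))
  (cover_content_sigma_subadditive cube_set (edge_powR_ge0 d)).

Lemma hausdorff_content_cube_le d Q : (H d (cube_set Q) <= (edge Q `^ d)%:E)%E.
Proof.
apply: ereal_inf_lbound; exists [set 0%N], (fun=> Q); split.
  by move=> x Qx; exists 0%N.
by rewrite esum_set1// lee_fin powR_ge0.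
Qed.

(** After scaling Q to edge 1, a covering cube of edge at least 1 already costs
    more than the content of Q, and for edges at most 1 a larger exponent
    lowers the cost. *)
Lemma hausdorff_content_mono_exponent d1 d2 Q E : 0 <= d1 <= d2 ->
  E `<=` cube_set Q -> (H d2 E <= (edge Q `^ (d2 - d1))%:E * H d1 E)%E.
Proof.
move=> /andP[d10 d12] EQ; set c := edge Q `^ _.
have c0 : 0 < c by exact: powR_gt0.
have cQ : c * edge Q `^ d1 = edge Q `^ d2.
  by rewrite /c -edge_powRD subrK.
rewrite -lee_pdivrMl//; apply: le_ereal_inf_tmp => _ [D [F [EF ->]]].
rewrite lee_pdivrMl//.
(* Either one covering cube is as large as Q, or all of them are smaller. *)
have [[k Dk Qk]|small] := pselect (exists2 k, D k & edge Q <= edge (F k)).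
  apply: (@le_trans _ _ (edge Q `^ d2)%:E).
    exact: le_trans (le_outer_measure (H d2) _ _ EQ) (hausdorff_content_cube_le _ _).
  rewrite -cQ EFinM lee_wpmul2l ?lee_fin ?powR_ge0//.
  apply: (@le_trans _ _ (edge (F k) `^ d1)%:E).
    by rewrite lee_fin ge0_ler_powR ?nnegrE ?edge_ge0.
  apply: esum_ge; exists [set k]; last by rewrite fsbig_set1.
  by split => // _ ->.
apply: (@le_trans _ _ (\esum_(k in D) (edge (F k) `^ d2)%:E)).
  by apply: ereal_inf_lbound; exists D, F.
rewrite esum_mkcond [X in (_ * X)%E]esum_mkcond -!nneseries_esumT; last 2 first.
- by move=> k; case: ifP; rewrite // lee_fin powR_ge0.
- by move=> k; case: ifP; rewrite // lee_fin powR_ge0.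
rewrite -nneseriesZl; last first.
  by move=> k _; case: ifP; rewrite // lee_fin powR_ge0.
apply: lee_nneseries => [k _ _|k _]; case: ifPn => //; rewrite ?mule0//.
  by rewrite lee_fin powR_ge0.
move=> /set_mem Dk; rewrite -EFinM lee_fin.
have kQ : edge (F k) <= edge Q.
  by rewrite leNgt; apply/negP => /ltW kQ; apply: small; exists k.
rewrite -[in leLHS](subrK d1 d2) edge_powRD.
by rewrite ler_wpM2r ?powR_ge0// ge0_ler_powR ?subr_ge0 ?nnegrE ?edge_ge0.
Qed.

Lemma cube_setE Q : cube_set Q = box (Q.1, Q.1 + const_mx (edge Q)).
Proof.
by rewrite /cube_set /box; apply/seteqP; split => x /= Qx i; have := Qx i;
  rewrite !mxE.
Qed.

Lemma box_volume_cube Q : box_volume (Q.1, Q.1 + const_mx (edge Q)) = edge Q ^+ n.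
Proof.
rewrite /box_volume (eq_bigr (fun=> edge Q)); last first.
  by move=> i _; rewrite /= !mxE addrAC subrr add0r max_r ?edge_ge0.
by rewrite prodr_const card_ord.
Qed.

Lemma lebesgue_outer_cube Q : lebesgue_outer (cube_set Q) = (edge Q ^+ n)%:E.
Proof. by rewrite cube_setE lebesgue_outer_box box_volume_cube. Qed.

Lemma lebesgue_outer_le_hausdorff E : (lebesgue_outer E <= H n%:R E)%E.
Proof.
apply: le_ereal_inf_tmp => _ [D [F [EF ->]]].
apply: ereal_inf_lbound.
exists D, (fun k => ((F k).1, (F k).1 + const_mx (edge (F k)))); split.
  by move=> x /EF[k Dk]; rewrite cube_setE => Fk; exists k.
by apply: eq_esum => k _; rewrite box_volume_cube powR_mulrn ?ltW.
Qed.

(** Comparing with the exponent n reduces the lower bound to the volume of a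
    box. *)
Lemma hausdorff_content_cube d Q : 0 <= d <= n%:R ->
  H d (cube_set Q) = (edge Q `^ d)%:E.
Proof.
move=> dn; apply/eqP; rewrite eq_le hausdorff_content_cube_le/=.
have /= := hausdorff_content_mono_exponent dn (@subset_refl _ (cube_set Q)).
move=> /(le_trans (lebesgue_outer_le_hausdorff _)).
rewrite lebesgue_outer_cube -lee_pdivrMl ?powR_gt0//; apply: le_trans.
rewrite -EFinM lee_fin -powR_mulrn; last exact: ltW.
by rewrite -powRN -edge_powRD opprB subrK.
Qed.

End hausdorff_content.

(** * The n-dimensional content is the Lebesgue outer measure *)

Section grid.
Context {R : realType} {n : nat}.
Local Notation H := (@hausdorff_content R n).

Lemma nat_ceil (u : R) : 0 < u -> exists j : nat, j%:R < u <= j.+1%:R.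
Proof.
move=> u0; have exj : exists j : nat, u <= j%:R.
  by exists (Num.truncn u).+1; rewrite ltW// truncnS_gt.
case: (ex_minnP exj) => -[|j]; first by rewrite leNgt u0.
move=> uj jmin; exists j; rewrite uj andbT ltNge; apply/negP => /jmin.
by rewrite ltnn.
Qed.

Lemma outer_measure_le_finite_cover (mu : {outer_measure set 'rV[R]_n -> \bar R})
    (I : finType) (P : pred I) (A : I -> set 'rV[R]_n) (E : set 'rV[R]_n) :
  (forall x, E x -> exists2 i, P i & A i x) ->
  (mu E <= \sum_(i | P i) mu (A i))%E.
Proof.
move=> EA; pose s := enum P.
apply: (@le_trans _ _ (mu (\bigcup_(k < size s) nth set0 (map A s) k))).
  apply: le_outer_measure => x /EA[i Pi Ai]; exists (index i s) => /=.
    by rewrite index_mem mem_enum.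
  rewrite (nth_map i) ?nth_index ?index_mem ?mem_enum//.
rewrite bigcup_mkord; apply: le_trans (outer_measure_subadditive _ _ _) _.
rewrite -(big_mkord xpredT (fun k => mu (nth set0 (map A s) k))) -(size_map A).
by rewrite -(big_nth _ xpredT) big_map -big_enum.
Qed.

(** The grid of mesh h has ceil (L_i / h) <= L_i / h + 1 steps in direction i,
    so its cubes have total volume at most the product of the L_i + h. *)
Lemma hausdorff_content_box_le_grid (B : 'rV[R]_n * 'rV[R]_n) (h : {posnum R}) :
  (forall i, B.1 ord0 i < B.2 ord0 i) ->
  (H n%:R (box B) <= (\prod_(i < n) (B.2 ord0 i - B.1 ord0 i + h%:num))%:E)%E.
Proof.
move=> B12.
(* The grid has (m i).+1 steps in direction i. *)
have /choice[m mP] (i : 'I_n) : exists j : nat,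
    j%:R < (B.2 ord0 i - B.1 ord0 i) / h%:num <= j.+1%:R.
  by apply: nat_ceil; rewrite divr_gt0// subr_gt0.
pose M := (\max_(i < n) m i).+1.
have mM i : ((m i).+1 <= M)%N by rewrite ltnS leq_bigmax.
pose corner (f : {ffun 'I_n -> 'I_M}) : 'rV[R]_n :=
  \row_i (B.1 ord0 i + (f i)%:R * h%:num).
pose P (f : {ffun 'I_n -> 'I_M}) := [forall i, (f i <= m i)%N].
apply: le_trans (@outer_measure_le_finite_cover _ _ P
   (fun f => cube_set (corner f, h)) _ _) _.
  move=> x Bx.
  have /choice[g gP] (i : 'I_n) : exists j : 'I_M, (j <= m i)%N /\
      j%:R < (x ord0 i - B.1 ord0 i) / h%:num <= j.+1%:R.
    have /andP[x1 x2] := Bx i.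
    have [|j /andP[j1 j2]] := @nat_ceil ((x ord0 i - B.1 ord0 i) / h%:num).
      by rewrite divr_gt0// subr_gt0.
    have jm : (j <= m i)%N.
      rewrite -ltnS -(ltr_nat R); apply: lt_le_trans j1 _.
      have /andP[_] := mP i; apply: le_trans.
      by rewrite ler_pM2r ?invr_gt0// lerD2r.
    have jM : (j < M)%N by rewrite ltnS (leq_trans jm)// leq_bigmax.
    by exists (Ordinal jM); rewrite jm j1 j2.
  exists [ffun i => g i]; first by apply/forallP => i; rewrite ffunE (gP i).1.
  move=> i; rewrite /corner mxE ffunE /edge /=.
  have [_ /andP[]] := gP i.
  rewrite ltr_pdivlMr// ler_pdivrMr// -natr1 mulrDl mul1r => g1 g2.
  by rewrite -ltrBrDl g1/= -addrA -lerBlDl g2.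
apply: (@le_trans _ _ (\sum_(f | P f) (\prod_(i < n) h%:num)%:E)%E).
  apply: lee_sum => f _; apply: le_trans (hausdorff_content_cube_le _ _) _.
  by rewrite prodr_const card_ord powR_mulrn ?edge_ge0.
rewrite sumEFin lee_fin.
rewrite big_mkcond/=.
rewrite (eq_bigr (fun f : {ffun 'I_n -> 'I_M} =>
   \prod_(i < n) if (f i <= m i)%N then h%:num else 0)); last first.
  move=> f _; rewrite /P; case: ifPn => [/forallP fm|].
    by apply: eq_bigr => i _; rewrite fm.
  by move=> /forallPn[i fi]; rewrite (bigD1 i)//= (negbTE fi) mul0r.
(* Counting the cubes of the grid is distributing a product over sums. *)
rewrite -(bigA_distr_bigA (fun i (j : 'I_M) => if (j <= m i)%N then h%:num else 0)).
apply: ler_prod => i _; apply/andP; split.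
  by apply: sumr_ge0 => j _; case: ifP.
rewrite -big_mkcond/= sumr_const.
have -> : #|[pred j : 'I_M | (j <= m i)%N]| = (m i).+1.
  have widen_inj : injective (widen_ord (mM i)).
    by move=> j k /(congr1 val) /= jk; exact: val_inj.
  rewrite -[RHS]card_ord -(card_imset _ widen_inj).
  apply: eq_card => j; rewrite !inE; apply/idP/imsetP => [ji|[k _ ->]].
    by exists (Ordinal (ji : (j < (m i).+1)%N)) => //; exact/val_inj.
  by rewrite /= -ltnS.
have /andP[mi _] := mP i.
rewrite -mulr_natl -natr1 mulrDl mul1r lerD2r.
by move: mi; rewrite ltr_pdivlMr// => /ltW.
Qed.

Lemma hausdorff_content_le_lebesgue_outer (E : set 'rV[R]_n) :
  (H n%:R E <= lebesgue_outer E)%E.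
Proof.
have boxle (B : 'rV[R]_n * 'rV[R]_n) : (H n%:R (box B) <= (box_volume B)%:E)%E.
  have [B12|] := pselect (forall i, B.1 ord0 i < B.2 ord0 i); last first.
    move=> /existsNP[i /negP]; rewrite -leNgt => Bi.
    rewrite (_ : box B = set0) ?outer_measure0 ?lee_fin ?box_volume_ge0//.
    apply/seteqP; split => // x /(_ i) /andP[x1 x2].
    by have := lt_le_trans x1 (le_trans x2 Bi); rewrite ltxx.
  (* The bound is a polynomial in the mesh h, whose value at 0 is the volume. *)
  pose f (h : R) := \prod_(i < n) (B.2 ord0 i - B.1 ord0 i + h).
  have f0 : f 0 = box_volume B.
    apply: eq_bigr => i _; rewrite addr0 max_r// subr_ge0 ltW//.
  have cf : f h @[h --> 0^'+] --> box_volume B.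
    rewrite -f0; apply: cvg_at_right_filter.
    rewrite (_ : f = horner (\prod_(i < n) ((B.2 ord0 i - B.1 ord0 i)%:P + 'X)%R)).
      exact: continuous_horner.
    apply/funext => h; rewrite horner_prod; apply: eq_bigr => i _.
    by rewrite !hornerE.
  have Hf h : 0 < h -> (H n%:R (box B) <= (f h)%:E)%E.
    by move=> h0; exact: (@hausdorff_content_box_le_grid B (PosNum h0)).
  have Hfin : H n%:R (box B) \is a fin_num.
    rewrite ge0_fin_numE ?outer_measure_ge0//.
    by apply: le_lt_trans (Hf 1 _) _; rewrite // ltry.
  rewrite -(fineK Hfin) lee_fin; apply: (cvgr_to_ge cf).
  near=> h; rewrite -lee_fin fineK//; apply: Hf.
  by near: h; exact: nbhs_right_gt.
apply: le_ereal_inf_tmp => _ [D [F [EF ->]]].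
apply: (@le_trans _ _ (\esum_(k in D) H n%:R (box (F k)))); last first.
  by apply: le_esum => k _; exact: boxle.
rewrite esum_mkcond -nneseries_esumT; last first.
  by move=> k; case: ifP => // _; exact: outer_measure_ge0.
pose A k := if k \in D then box (F k) else set0.
apply: (@le_trans _ _ (H n%:R (\bigcup_k A k))).
  apply: le_outer_measure => x /EF[k Dk Fk]; exists k => //.
  by rewrite /A mem_set.
apply: le_trans (outer_measure_sigma_subadditive _ _) _.
apply: lee_nneseries => [k _ _|k _]; first exact: outer_measure_ge0.
by rewrite /A; case: ifP => // _; rewrite outer_measure0.
Unshelve. all: by end_near. Qed.

Lemma hausdorff_content_lebesgue :
  @hausdorff_content R n n%:R = @lebesgue_outer R n.
Proof.
apply/funext => E; apply/eqP; rewrite eq_le lebesgue_outer_le_hausdorff andbT.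
exact: hausdorff_content_le_lebesgue_outer.
Qed.

End grid.

(** * Lebesgue measure on the space of row vectors *)

Section lebesgue_rV.
Context {R : realType} {n : nat}.
Local Notation mu := (@lebesgue_measure_rV R n).

(** A hyperplane cuts a box into two boxes whose volumes add up; this is what
    makes half-spaces Caratheodory measurable. *)
Lemma box_splitI (B : 'rV[R]_n * 'rV[R]_n) (i : 'I_n) (a : R) :
  let lo := (B.1, \row_j if j == i then Num.min (B.2 ord0 i) a else B.2 ord0 j) in
  let hi := (\row_j (if j == i then Num.max (B.1 ord0 i) a else B.1 ord0 j), B.2) in
  [/\ box B `&` [set x | x ord0 i <= a] `<=` box lo,
      box B `&` ~` [set x | x ord0 i <= a] `<=` box hi &
      box_volume lo + box_volume hi = box_volume B].
Proof.
move=> lo hi; split.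
- move=> x [Bx /= xa] j; have /andP[x1 x2] := Bx j.
  by rewrite /lo/= mxE x1; case: eqVneq x2 => [->|//] x2; rewrite le_min x2 xa.
- move=> x [Bx /= /negP]; rewrite -ltNge => xa j; have /andP[x1 x2] := Bx j.
  by rewrite /hi/= mxE x2 andbT; case: eqVneq x1 => [->|//] x1; rewrite gt_max x1 xa.
rewrite /box_volume (bigD1 i)//= [X in _ + X](bigD1 i)//= [RHS](bigD1 i)//=.
rewrite !mxE eqxx.
rewrite (eq_bigr (fun j => Num.max 0 (B.2 ord0 j - B.1 ord0 j))); last first.
  by move=> j /negbTE ji; rewrite mxE ji.
rewrite [X in _ + _ * X](eq_bigr
  (fun j => Num.max 0 (B.2 ord0 j - B.1 ord0 j))); last first.
  by move=> j /negbTE ji; rewrite mxE ji.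
rewrite -mulrDl; congr (_ * _).
case: (leP (B.2 ord0 i) a); case: (leP (B.1 ord0 i) a) => ? ?;
  by repeat (case: leP => ?); lra.
Qed.

Lemma measurable_halfspace (i : 'I_n) (a : R) :
  measurable ([set x | x ord0 i <= a] : set (lebesgue_rV R n)).
Proof.
apply: le_caratheodory_measurable => X.
apply: le_ereal_inf_tmp => _ [D [F [XF ->]]].
pose lo k := ((F k).1,
  \row_j if j == i then Num.min ((F k).2 ord0 i) a else (F k).2 ord0 j).
pose hi k := (\row_j (if j == i then Num.max ((F k).1 ord0 i) a
   else (F k).1 ord0 j), (F k).2).
apply: (@le_trans _ _ (\esum_(k in D) (box_volume (lo k))%:E +
                       \esum_(k in D) (box_volume (hi k))%:E)%E).
  apply: leeD; apply: ereal_inf_lbound.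
    exists D, lo; split => // x [/XF[k Dk Fx] xa]; exists k => //.
    by have [+ _ _] := box_splitI (F k) i a; exact.
  exists D, hi; split => // x [/XF[k Dk Fx] xa]; exists k => //.
  by have [_ + _] := box_splitI (F k) i a; exact.
rewrite -esumD; last 2 first.
- by move=> k _; rewrite lee_fin box_volume_ge0.
- by move=> k _; rewrite lee_fin box_volume_ge0.
apply: le_esum => k _; rewrite -EFinD lee_fin.
by have [_ _ ->] := box_splitI (F k) i a.
Qed.

Lemma measurable_cube_set (Q : cube R n) :
  measurable (cube_set Q : set (lebesgue_rV R n)).
Proof.
rewrite (_ : cube_set Q = \bigcap_(i in [set: 'I_n])
    ([set x | x ord0 i <= Q.1 ord0 i + edge Q] `\`
     [set x | x ord0 i <= Q.1 ord0 i])); last first.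
  apply/seteqP; split => x /= Qx i.
    by move=> _; have /andP[x1 x2] := Qx i; split => //=; apply/negP; rewrite -ltNge.
  by have [//|/= x2 /negP] := Qx i; rewrite -ltNge => ->.
apply: fin_bigcap_measurable => // i _.
by apply: measurableD; exact: measurable_halfspace.
Qed.

Definition centered_cube (r : {posnum R}) : cube R n :=
  (const_mx (- r%:num), (r%:num *+ 2)%:pos).

Lemma centered_cubeP r (x : 'rV[R]_n) : (forall i, `|x ord0 i| < r%:num) ->
  cube_set (centered_cube r) x.
Proof.
move=> xr i; rewrite mxE /edge/=; have := xr i; rewrite ltr_norml => /andP[-> x2].
by rewrite /= mulr2n addKr ltW.
Qed.

Lemma bigcup_centered_cube :
  \bigcup_k cube_set (centered_cube k.+1%:R%:pos) = [set: 'rV[R]_n].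
Proof.
apply/seteqP; split => // x _; pose s := \sum_(i < n) `|x ord0 i|.
exists (Num.truncn s) => //; apply: centered_cubeP => i.
apply: le_lt_trans (truncnS_gt s); rewrite /s (bigD1 i)//= lerDl.
exact: sumr_ge0.
Qed.

Lemma lebesgue_measure_rV_sigma_finite : sigma_finite [set: lebesgue_rV R n] mu.
Proof.
exists (fun k => cube_set (centered_cube (k.+1%:R%:pos)) : set (lebesgue_rV R n)).
  exact/esym/bigcup_centered_cube.
move=> k; split; first exact: measurable_cube_set.
by rewrite [X in (X < _)%E]lebesgue_outer_cube ltry.
Qed.

HB.instance Definition _ := @Measure_isSigmaFinite.Build _ _ _ mu
  lebesgue_measure_rV_sigma_finite.

End lebesgue_rV.

(** * Choquet integrals, and the classical Muckenhoupt classes *)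

Section choquet.
Context {R : realType} {n : nat}.
Local Open Scope ereal_scope.
Implicit Types (d : R) (Q : cube R n) (E F : set 'rV[R]_n)
  (f g w : 'rV[R]_n -> \bar R).
Local Notation H := (@hausdorff_content R n).
Local Notation mu := (@lebesgue_measure_rV R n).

Lemma choquet_integral_ge0 d E f : 0 <= choquet_integral d E f.
Proof. by apply: integral_ge0 => t _; exact: outer_measure_ge0. Qed.

Lemma choquet_integral_le d E F f g : E `<=` F ->
  (forall x, E x -> f x <= g x) ->
  choquet_integral d E f <= choquet_integral d F g.
Proof.
move=> EF fg; apply: nonneg_le_integral => t _; first exact: outer_measure_ge0.
apply: le_outer_measure => x [Ex /= tf]; split; first exact: EF.
exact: lt_le_trans tf (fg _ Ex).
Qed.

Lemma compact_sub_cube E : compact E -> exists Q, E `<=` cube_set Q.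
Proof.
move=> cE.
have /choice[M MP] (i : 'I_n) : exists M : R, forall x, E x -> (`|x ord0 i| <= M)%R.
  have cEi : compact ((fun x : 'rV[R]_n => x ord0 i) @` E).
    apply: continuous_compact => //; apply: continuous_subspaceT.
    exact: coord_continuous.
  have [M [_ MP]] := compact_bounded cEi.
  exists (M + 1)%R => x Ex; apply: (MP (M + 1)%R); first by rewrite ltrDl.
  by exists x.
have r0 : (0 < 1 + \sum_i `|M i|)%R.
  by rewrite ltr_pwDl// sumr_ge0.
exists (centered_cube (PosNum r0)) => x Ex; apply: centered_cubeP => i.
rewrite (le_lt_trans (MP i x Ex))//= (le_lt_trans (ler_norm _))//.
by rewrite (bigD1 i)//= addrCA ltrDl ltr_pwDl// sumr_ge0.
Qed.

Lemma cube_sub_compact Q : exists2 K, compact K & cube_set Q `<=` K.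
Proof.
pose I i := `[Q.1 ord0 i, (Q.1 ord0 i + edge Q)%R]%classic.
exists [set x : 'rV[R]_n | forall i, I i (x ord0 i)].
  apply: (@rV_compact _ _ I).
  by move=> i; exact: segment_compact.
by move=> x Qx i; have /andP[x1 x2] := Qx i; rewrite /I /= in_itv/= ltW.
Qed.

(** Cubes are half-open, hence not compact, but each is contained in a compact
    box and each compact set in a cube. *)
Lemma choquet_integral_compactP d w :
  (forall E, compact E -> choquet_integral d E w < +oo) <->
  (forall Q, choquet_integral d (cube_set Q) w < +oo).
Proof.
split=> [wfin Q|wfin E /compact_sub_cube[Q EQ]].
  have [K cK QK] := cube_sub_compact Q.
  by apply: le_lt_trans (wfin _ cK); exact: choquet_integral_le.
by apply: le_lt_trans (wfin Q); exact: choquet_integral_le.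
Qed.

Lemma choquet_integral_lebesgue E f :
  measurable (E : set (lebesgue_rV R n)) -> lebesgue_measurable f ->
  (forall x, 0 <= f x) ->
  choquet_integral n%:R E f = \int[mu]_(x in E) f x.
Proof.
move=> mE mf f0; rewrite (layer_cake mu mE mf f0).
by apply: eq_integral => t _; rewrite hausdorff_content_lebesgue.
Qed.

Lemma capacitary_average_lebesgue Q f : lebesgue_measurable f ->
  (forall x, 0 <= f x) -> capacitary_average n%:R Q f = average Q f.
Proof.
move=> mf f0; rewrite /capacitary_average choquet_integral_lebesgue//.
  by rewrite hausdorff_content_lebesgue.
exact: measurable_cube_set.
Qed.

(** Null sets of an outer measure are Caratheodory measurable, so the sets of
    content zero are the negligible sets. *)
Lemma content_ae_lebesgue (P : 'rV[R]_n -> Prop) :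
  content_ae n%:R P <-> {ae mu, forall x, P x}.
Proof.
rewrite /content_ae hausdorff_content_lebesgue; split => [[N N0 NP]|[N [mN N0 NP]]].
  exists N; split => //; last first.
    by move=> x /= Px; apply: contrapT => /NP.
  apply: (@measure_is_complete_caratheodory _ _ (@lebesgue_outer R n) N).
  exists N; split => //.
  apply: le_caratheodory_measurable => X.
  apply: (@le_trans _ _ (lebesgue_outer N + lebesgue_outer X)); last first.
    by rewrite N0 add0e.
  by apply: leeD; apply: le_outer_measure => x [].
exists N => // x; apply: contra_notP => /NP; exact.
Qed.

Lemma L1locP w : (forall x, 0 <= w x) -> lebesgue_measurable w ->
  L1loc w <-> forall E, compact E -> choquet_integral n%:R E w < +oo.
Proof.
move=> w0 mw; have absw E : \int[mu]_(x in E) `|w x| = \int[mu]_(x in E) w x.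
  by apply: eq_integral => x _; rewrite gee0_abs.
have int_le E F : E `<=` F -> \int[mu]_(x in E) w x <= \int[mu]_(x in F) w x.
  move=> EF; rewrite integral_mkcond [leRHS]integral_mkcond.
  apply: nonneg_le_integral => x _; rewrite /patch; first by case: ifP.
  by case: ifPn => [/set_mem /EF /mem_set ->//|_]; case: ifP.
have intQ Q : choquet_integral n%:R (cube_set Q) w = \int[mu]_(x in cube_set Q) w x.
  by apply: choquet_integral_lebesgue => //; exact: measurable_cube_set.
rewrite choquet_integral_compactP; split => [[_ wfin] Q|wfin].
  rewrite intQ; have [K cK QK] := cube_sub_compact Q.
  by apply: le_lt_trans (int_le _ _ QK) _; rewrite -absw; exact: wfin.
split=> // E /compact_sub_cube[Q EQ]; rewrite absw.
by apply: le_lt_trans (int_le _ _ EQ) _; rewrite -intQ.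
Qed.

Lemma dual_weight_ge0 (p : R) w x : 0 <= dual_weight p w x.
Proof. by rewrite inve_ge0 poweR_ge0. Qed.

Lemma measurable_dual_weight (p : R) w : lebesgue_measurable w ->
  lebesgue_measurable (dual_weight p w).
Proof.
move=> mw; apply: measurable_fun_inve => [x|]; first exact: poweR_ge0.
exact: measurableT_comp (measurable_poweR _) mw.
Qed.

Lemma capacitary_maximal_lebesgue w : lebesgue_measurable w ->
  capacitary_maximal n%:R w = hardy_littlewood w.
Proof.
move=> mw; apply/funext => x; congr ereal_sup; apply: eq_imagel => Q _.
apply: capacitary_average_lebesgue => //.
exact: measurableT_comp (@abse_measurable _ _) mw.
Qed.

Lemma capacitary_Ap_lebesgue (p : R) w : lebesgue_measurable w ->
  capacitary_Ap n%:R p w <-> muckenhoupt_Ap p w.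
Proof.
move=> mw.
have constE : (forall x, 0 <= w x) ->
    capacitary_Ap_const n%:R p w = muckenhoupt_Ap_const p w.
  move=> w0; congr ereal_sup; apply: eq_imagel => Q _.
  rewrite !capacitary_average_lebesgue//; last exact: dual_weight_ge0.
  exact: measurable_dual_weight.
rewrite /capacitary_Ap /muckenhoupt_Ap /= capacitary_maximal_lebesgue//.
split=> [[[w0 wfin wpos] wA]|[w0 wloc wpos wA]].
  split => //; [exact/L1locP|exact/content_ae_lebesgue|].
  move: wA; case: ifP => _; last by rewrite constE.
  move=> [K K0 /content_ae_lebesgue KA]; apply/ess_sup_ratio_ltyP; last by exists K.
  exact/content_ae_lebesgue.
split; first by split => //; [exact/L1locP|exact/content_ae_lebesgue].
move: wA; case: ifP => _; last by rewrite constE.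
move=> /(ess_sup_ratio_ltyP _ wpos)[K K0 KA]; exists K => //.
exact/content_ae_lebesgue.
Qed.

End choquet.

(** * Monotonicity in the exponent *)

Section exponent_monotonicity.
Context {R : realType} {n : nat}.
Local Open Scope ereal_scope.
Implicit Types (d : R) (Q : cube R n) (E F : set 'rV[R]_n)
  (f g w : 'rV[R]_n -> \bar R).
Local Notation H := (@hausdorff_content R n).

Lemma le_choquet_integral_exponent d1 d2 Q f : (0 <= d1 <= d2)%R ->
  choquet_integral d2 (cube_set Q) f <=
  (edge Q `^ (d2 - d1))%:E * choquet_integral d1 (cube_set Q) f.
Proof.
move=> d12; rewrite -ge0_integralZl_EFin//; last first.
- exact: powR_ge0.
- apply: nonincreasing_emeasurable => s t st; apply: le_outer_measure.
  by move=> x [Qx /= tx]; split=> //=; apply: le_lt_trans tx; rewrite lee_fin.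
- by move=> t _; exact: outer_measure_ge0.
apply: nonneg_le_integral => t _; first exact: outer_measure_ge0.
by apply: hausdorff_content_mono_exponent => // x [].
Qed.

Lemma capacitary_averageE d Q f : (0 <= d <= n%:R)%R ->
  capacitary_average d Q f =
  choquet_integral d (cube_set Q) f * (edge Q `^ (- d))%:E.
Proof.
move=> dn; rewrite /capacitary_average hausdorff_content_cube// inver powRN.
by rewrite gt_eqF ?powR_gt0.
Qed.

Lemma capacitary_average_ge0 d Q f : 0 <= capacitary_average d Q f.
Proof.
by rewrite mule_ge0 ?choquet_integral_ge0// inve_ge0 outer_measure_ge0.
Qed.

Lemma le_capacitary_average_exponent d1 d2 Q f : (0 <= d1 <= d2)%R ->
  (d2 <= n%:R)%R -> capacitary_average d2 Q f <= capacitary_average d1 Q f.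
Proof.
move=> /andP[d10 d12] d2n.
rewrite !capacitary_averageE ?d10 ?(le_trans d12)// ?(le_trans d10 d12)//.
apply: (@le_trans _ _ ((edge Q `^ (d2 - d1))%:E *
    choquet_integral d1 (cube_set Q) f * (edge Q `^ (- d2))%:E)).
  by rewrite lee_wpmul2r ?lee_fin ?powR_ge0// le_choquet_integral_exponent ?d10.
by rewrite muleAC -EFinM -edge_powRD addrAC subrr add0r muleC.
Qed.

(** The comparison of contents is local to a cube; countably many cubes cover
    the space. *)
Lemma hausdorff_content_null_exponent d1 d2 E : (0 <= d1 <= d2)%R ->
  H d1 E = 0 -> H d2 E = 0.
Proof.
move=> d12 E0; apply/eqP; rewrite eq_le outer_measure_ge0 andbT.
rewrite -(setIT E) -bigcup_centered_cube setI_bigcupr.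
apply: le_trans (outer_measure_sigma_subadditive _ _) _.
rewrite eseries0// => k _ _; apply/eqP; rewrite eq_le outer_measure_ge0 andbT.
set Q := centered_cube _.
apply: le_trans (hausdorff_content_mono_exponent d12 (@subIsetr _ E (cube_set Q))) _.
rewrite (_ : H d1 _ = 0) ?mule0//; apply/eqP.
by rewrite eq_le outer_measure_ge0 andbT -E0 le_outer_measure.
Qed.

Lemma content_ae_exponent d1 d2 (P : 'rV[R]_n -> Prop) : (0 <= d1 <= d2)%R ->
  content_ae d1 P -> content_ae d2 P.
Proof.
by move=> d12 [N N0 NP]; exists N; [exact: hausdorff_content_null_exponent d12 N0|].
Qed.

Lemma capacitary_weight_exponent d1 d2 w : (0 <= d1 <= d2)%R ->
  capacitary_weight d1 w -> capacitary_weight d2 w.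
Proof.
move=> d12 [w0 wfin wpos]; split; [exact: w0| |exact: content_ae_exponent d12 wpos].
apply/choquet_integral_compactP => Q.
apply: le_lt_trans (le_choquet_integral_exponent _ _ d12) _.
have /choquet_integral_compactP wQ := wfin.
apply: lte_mul_pinfty (wQ Q); first by rewrite lee_fin powR_ge0.
by [].
Qed.

Lemma capacitary_Ap_exponent d1 d2 (p : R) : (0 <= d1 <= d2)%R ->
  (d2 <= n%:R)%R -> (1 <= p)%R ->
  @capacitary_Ap R n d1 p `<=` @capacitary_Ap R n d2 p.
Proof.
move=> d12 d2n p1 w; rewrite /capacitary_Ap /= => -[ww wA].
split; first exact: (capacitary_weight_exponent d12).
move: wA; case: (p == 1%R).
  move=> [K K0 wK]; exists K; first exact: K0.
  apply: (content_ae_exponent d12).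
  case: wK => N N0 NP; exists N; first exact: N0.
  move=> x /NP; apply: le_trans; apply: ge_ereal_sup => _ [Q Qx <-].
  apply: le_trans (le_capacitary_average_exponent _ _ d12 d2n) _.
  by apply: ereal_sup_ubound; exists Q.
apply: le_lt_trans; apply: ge_ereal_sup => _ [Q _ <-].
apply: (@le_trans _ _ (capacitary_average d1 Q w *
    capacitary_average d1 Q (dual_weight p w) `^ (p - 1))); last first.
  by apply: ereal_sup_ubound; exists Q.
have avg0 d f : capacitary_average d Q f \in `[0, +oo].
  by rewrite in_itv/= capacitary_average_ge0 leey.
apply: lee_pmul.
- exact: capacitary_average_ge0.
- exact: poweR_ge0.
- exact: le_capacitary_average_exponent d12 d2n.
- apply: gt0_ler_poweR; [by rewrite subr_ge0|exact: avg0|exact: avg0|].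
  exact: le_capacitary_average_exponent d12 d2n.
Qed.

End exponent_monotonicity.

(** * Weights whose averages are controlled by their infimum *)

Section infimum_bound.
Context {R : realType} {n : nat}.
Local Open Scope ereal_scope.
Implicit Types (d : R) (Q : cube R n) (E F : set 'rV[R]_n)
  (f g w : 'rV[R]_n -> \bar R).
Local Notation H := (@hausdorff_content R n).

Lemma markov_choquet d E f (t : R) : (0 < t)%R ->
  t%:E * H d (E `&` [set x | t%:E < f x]) <= choquet_integral d E f.
Proof.
move=> t0; set h := H d _.
have -> : t%:E * h = \int[lebesgue_measure]_(s in `]0%R, t[) h.
  rewrite integral_cst//= lebesgue_measure_itv/= lte_fin t0 oppr0 adde0 muleC//.
rewrite integral_mkcond [leRHS]integral_mkcond.
apply: nonneg_le_integral => s _; rewrite /patch.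
  by case: ifP => // _; exact: outer_measure_ge0.
case: ifPn => [|_]; last by case: ifP => // _; exact: outer_measure_ge0.
rewrite inE/= in_itv/= => /andP[s0 st]; rewrite mem_set/= ?in_itv/= ?s0//.
apply: le_outer_measure => x [Ex /= tx]; split => //=.
by apply: lt_trans tx; rewrite lte_fin.
Qed.

Lemma capacitary_average_le_bound d Q f (c : R) : (0 <= d <= n%:R)%R ->
  (0 <= c)%R -> (forall x, cube_set Q x -> f x <= c%:E) ->
  capacitary_average d Q f <= c%:E.
Proof.
move=> dn c0 fc; rewrite capacitary_averageE//.
suff : choquet_integral d (cube_set Q) f <= c%:E * (edge Q `^ d)%:E.
  have l0 : 0 <= (edge Q `^ (- d))%:E by rewrite lee_fin powR_ge0.
  move=> /(lee_wpmul2r l0) /le_trans; apply.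
  by rewrite -(EFinM c) -EFinM -mulrA -edge_powRD subrr powRr0 mulr1.
have -> : c%:E * (edge Q `^ d)%:E =
    \int[lebesgue_measure]_(s in `]0%R, c[) (edge Q `^ d)%:E.
  rewrite integral_cst//= lebesgue_measure_itv/= lte_fin muleC.
  by case: ltgtP c0 => // [c0 _|<- _]; rewrite ?oppr0 ?adde0// mule0.
rewrite /choquet_integral integral_mkcond [leRHS]integral_mkcond.
apply: nonneg_le_integral => s _; rewrite /patch.
  by case: ifP => // _; exact: outer_measure_ge0.
case: ifPn => [|_]; last by case: ifP => //; rewrite lee_fin powR_ge0.
rewrite inE/= in_itv/= andbT => s0; case: ifPn => [_|].
  apply: le_trans (hausdorff_content_cube_le _ _).
  by apply: le_outer_measure => x [].
rewrite notin_setE/= in_itv/= s0/= => /negP; rewrite -leNgt => cs.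
rewrite (_ : _ `&` _ = set0) ?outer_measure0//.
apply/seteqP; split => // x [Qx /= sf].
by have := lt_le_trans sf (fc x Qx); rewrite lte_fin ltNge cs.
Qed.

(** An A_1 bound that holds everywhere implies all A_p bounds: if c <= w on Q
    then the dual weight is at most c^(-1/(p-1)) on Q, and so is its average;
    the powers of c cancel in the A_p constant. *)
Lemma capacitary_Ap_of_infimum d (p K : R) w : (0 <= d <= n%:R)%R ->
  (1 <= p)%R -> (0 < K)%R -> capacitary_weight d w ->
  (forall Q, exists c : R, [/\ (0 < c)%R,
     forall x, cube_set Q x -> c%:E <= w x &
     capacitary_average d Q w <= (K * c)%:E]) ->
  capacitary_Ap d p w.
Proof.
move=> dn p1 K0 ww wK; split => //; case: ifPn => [_|/eqP pn1].
  exists K => //; exists set0; first exact: outer_measure0.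
  move=> x _; apply: ge_ereal_sup => _ [Q /= Qx <-].
  have [c [c0 cw avg]] := wK Q; have [w0 _ _] := ww.
  have -> : (fun y => `|w y|) = w by apply/funext => y; rewrite gee0_abs.
  apply: le_trans avg _; rewrite EFinM; apply: lee_wpmul2l.
    by rewrite lee_fin ltW.
  exact: cw.
have p0 : (0 < p - 1)%R.
  by rewrite subr_gt0 lt_neqAle p1 andbT; apply/eqP => p1'; apply: pn1.
apply: (@le_lt_trans _ _ K%:E); last exact: ltry.
apply: ge_ereal_sup => _ [Q _ <-].
have [c [c0 cw avg]] := wK Q; have [w0 _ _] := ww.
pose e := (c `^ (p - 1)^-1)^-1%R.
have e0 : (0 < e)%R by rewrite invr_gt0 powR_gt0.
have dual_le : capacitary_average d Q (dual_weight p w) <= e%:E.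
  apply: capacitary_average_le_bound => // [|x /cw cwx]; first exact: ltW.
  rewrite /dual_weight inve_ple ?inE ?poweR_ge0 ?lee_fin ?(ltW e0)//.
  rewrite inver gt_eqF// /e invrK -poweR_EFin.
  by apply: gt0_ler_poweR;
    rewrite ?invr_ge0 ?(ltW p0)// in_itv/= ?leey ?lee_fin ?w0 ?ltW.
apply: (@le_trans _ _ ((K * c)%:E * e%:E `^ (p - 1))).
  apply: lee_pmul => //; rewrite ?capacitary_average_ge0 ?poweR_ge0//.
  by apply: gt0_ler_poweR; rewrite ?(ltW p0)// in_itv/= ?leey
    ?capacitary_average_ge0 ?lee_fin ?ltW.
rewrite poweR_EFin -EFinM lee_fin /e -powRN -powRrM mulNr mulVf ?gt_eqF//.
rewrite powRN powRr1; last exact: ltW.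
by rewrite mulfK ?gt_eqF.
Qed.

End infimum_bound.

(** * The power weights *)

Section power_weight.
Context {R : realType} {n : nat}.
Implicit Types (x : 'rV[R]_n) (Q : cube R n).
Local Notation H := (@hausdorff_content R n).

Lemma coord_le_norm x i : `|x ord0 i| <= `|x|.
Proof.
rewrite [leRHS]mx_normrE.
exact: (le_bigmax _ (fun ij : 'I_1 * 'I_n => `|x ij.1 ij.2|) (ord0, i)).
Qed.

Lemma norm_le_coord x r : 0 <= r -> (forall i, `|x ord0 i| <= r) -> `|x| <= r.
Proof.
move=> r0 xr; rewrite [leLHS]mx_normrE; apply/bigmax_leP; split=> // -[i j] _ /=.
by rewrite (ord1 i).
Qed.

Lemma edge_centered_cube (r : {posnum R}) :
  edge (centered_cube r : cube R n) = 2 * r%:num.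
Proof. by rewrite /edge/= mulr_natl. Qed.

Lemma norm_lt_centered_cube x (r : {posnum R}) : `|x| < r%:num ->
  cube_set (centered_cube r) x.
Proof.
move=> xr; apply: centered_cubeP => i; apply: le_lt_trans xr.
exact: coord_le_norm.
Qed.

Lemma centered_cube_norm_le x (r : {posnum R}) :
  cube_set (centered_cube r) x -> `|x| <= r%:num.
Proof.
move=> xr; apply: norm_le_coord => // i; have := xr i.
by rewrite /centered_cube /edge /= mxE mulr2n addKr ler_norml => /andP[/ltW -> ->].
Qed.

(** The inverse is taken in the extended reals, so that the weight is +oo, and
    its dual weight 0, at the origin; with the value 0 at the origin the dual
    weight would not be bounded on cubes around it. *)
Definition power_weight (a : R) x : \bar R := ((`|x| `^ a)%:E^-1)%E.

Lemma power_weight_ge0 a x : (0 <= power_weight a x)%E.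
Proof. by rewrite inve_ge0 lee_fin powR_ge0. Qed.

Lemma power_weight_lower a x m : 0 <= a -> 0 < m -> `|x| <= m ->
  ((m `^ (- a))%:E <= power_weight a x)%E.
Proof.
move=> a0 m0 xm; rewrite inve_pge ?inE ?lee_fin ?powR_ge0// inver powRN.
rewrite invr_eq0 gt_eqF ?powR_gt0// invrK lee_fin.
by rewrite ge0_ler_powR ?nnegrE ?normr_ge0 ?(ltW m0).
Qed.

Lemma power_weight_upper a x m : 0 <= a -> 0 < m -> m <= `|x| ->
  (power_weight a x <= (m `^ (- a))%:E)%E.
Proof.
move=> a0 m0 xm; rewrite inve_ple ?inE ?lee_fin ?powR_ge0// inver powRN.
rewrite invr_eq0 gt_eqF ?powR_gt0// invrK lee_fin.
by rewrite ge0_ler_powR ?nnegrE ?normr_ge0 ?(ltW m0).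
Qed.

Lemma power_weight_gt_norm a x t : 0 < a -> 0 < t ->
  (t%:E < power_weight a x)%E -> `|x| < t `^ (- a^-1).
Proof.
move=> a0 t0 tw; rewrite ltNge; apply/negP => xt; move: tw.
apply/negP; rewrite -leNgt.
have := power_weight_upper (ltW a0) (powR_gt0 _ t0) xt.
by rewrite -powRrM mulrNN mulVf ?gt_eqF// powRr1// ltW.
Qed.

Lemma cube_norm_upper Q x : cube_set Q x -> `|x| <= `|Q.1| + edge Q.
Proof.
move=> Qx; apply: norm_le_coord => [|i].
  by rewrite addr_ge0 ?normr_ge0 ?edge_ge0.
have /andP[x1 x2] := Qx i; have := coord_le_norm Q.1 i.
rewrite !ler_norml => /andP[q1 q2]; apply/andP; split; last first.
  by apply: le_trans x2 _; rewrite lerD2r.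
by rewrite opprD lerBlDr (le_trans q1)// (le_trans (ltW x1))// lerDl edge_ge0.
Qed.

Lemma cube_norm_lower Q x : cube_set Q x -> `|Q.1| - edge Q <= `|x|.
Proof.
move=> Qx; rewrite lerBlDr; apply: norm_le_coord => [|i].
  by rewrite addr_ge0 ?normr_ge0 ?edge_ge0.
have /andP[x1 x2] := Qx i; have := coord_le_norm x i.
rewrite !ler_norml => /andP[q1 q2]; apply/andP; split; last first.
  by apply: le_trans (ltW x1) _; rewrite (le_trans q2)// lerDl edge_ge0.
by rewrite opprD lerBlDr (le_trans q1).
Qed.

Lemma integral_powR_tail (s T : R) : 0 < s -> 0 < T ->
  (\int[lebesgue_measure]_(t in `[T, +oo[) (t `^ (- (s + 1)))%:E =
   (s^-1 * T `^ (- s))%:E)%E.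
Proof.
move=> s0 T0.
pose F (t : R) := (- s^-1) * t `^ (- s).
have dF (t : R) : 0 < t -> is_derive t (1 : R) F (t `^ (- (s + 1))).
  move=> t0; have := is_derive1_powR (- s) t0 => dp.
  rewrite opprD; apply: is_derive_eq.
  by rewrite /GRing.scale/= mulrA mulrNN mulVf ?gt_eqF// mul1r.
have pos : \forall t \near +oo, 0 < t `^ s.
  near=> t; apply: powR_gt0; near: t; exact: nbhs_pinfty_gt.
have toy : t `^ s @[t --> +oo] --> +oo.
  apply/cvgryPge => A.
  have [M M0 AM] : exists2 M : R, 0 < M & A <= M.
    by exists (Num.max 1 A); [rewrite lt_max ltr01|rewrite le_max lexx orbT].
  have large (t : R) : M `^ s^-1 <= t -> A <= t `^ s.
    move=> Mt; apply: (le_trans AM).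
    rewrite -[leLHS](powRr1 (ltW M0)) -(mulVf (lt0r_neq0 s0)) powRrM.
    have t0 : 0 <= t by apply: le_trans Mt; exact: powR_ge0.
    by rewrite ge0_ler_powR ?nnegrE ?powR_ge0 ?(ltW s0).
  by near=> t; apply: large; near: t; apply: nbhs_pinfty_ge; exact: num_real.
rewrite (@ge0_continuous_FTC2y _ _ F T 0).
- by rewrite sub0e -EFinN /F mulNr opprK.
- by move=> t _; exact: powR_ge0.
- apply: derivable_within_continuous => t; rewrite in_itv/= andbT => Tt.
  by apply: derivable_powR; rewrite in_itv/= andbT (lt_le_trans T0).
- rewrite -(mulr0 (- s^-1)); apply: cvgMr.
  under eq_cvg do rewrite powRN.
  exact: (gtr0_cvgV0 pos).2 toy.
- by move=> t Tt; have [] := dF t (lt_trans T0 Tt).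
- apply: cvg_at_right_filter; apply: differentiable_continuous.
  by apply/derivable1_diffP; have [] := dF T T0.
- move=> t; rewrite in_itv/= andbT => Tt.
  by rewrite derive1E; have [_ ->] := dF t (lt_trans T0 Tt).
Unshelve. all: by end_near. Qed.

End power_weight.

Section power_weight_Ap.
Context {R : realType} {n : nat}.
Implicit Types (x : 'rV[R]_n) (Q : cube R n).
Local Notation H := (@hausdorff_content R n).

(** The superlevel set at t, within Q, has content at most l^n, and also at
    most (2 t^(-1/a))^n since it lies in a cube around the origin.  The two
    bounds are integrated below and above the level T = l^-a, where they are
    comparable; a < n makes the second one integrable at infinity. *)
Lemma choquet_power_weight_le (a : R) Q : 0 < a < n%:R ->
  (choquet_integral n%:R (cube_set Q) (power_weight a) <=
   ((1 + 2 `^ n%:R / (n%:R / a - 1)) * edge Q `^ (n%:R - a))%:E)%E.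
Proof.
move=> /andP[a0 an]; set s := n%:R / a - 1; set l := edge Q.
have l0 : 0 < l := edge_gt0 Q.
have s0 : 0 < s by rewrite subr_gt0 ltr_pdivlMr// mul1r.
have sE : a * s = n%:R - a by rewrite mulrBr mulr1 mulrCA divff ?mulr1// gt_eqF.
have sE1 : n%:R / a = s + 1 by rewrite subrK.
pose T := l `^ (- a); have T0 : 0 < T by rewrite powR_gt0.
pose h1 : R -> \bar R := (cst (l `^ n%:R)%:E) \_ `]0, T].
pose h2 : R -> \bar R :=
  (fun t => (2 `^ n%:R)%:E * (t `^ (- (s + 1)))%:E)%E \_ `[T, +oo[.
have h10 t : (0 <= h1 t)%E.
  by rewrite /h1 patchE; case: ifP => // _; rewrite lee_fin powR_ge0.
have h20 t : (0 <= h2 t)%E.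
  by rewrite /h2 patchE; case: ifP => // _; rewrite -EFinM lee_fin mulr_ge0 ?powR_ge0.
have mg : measurable_fun [set: R] (fun t : R => (t `^ (- (s + 1)))%:E).
  by apply/measurable_EFinP; exact: measurable_powR.
apply: (@le_trans _ _ (\int[lebesgue_measure]_(t in `]0%R, +oo[) (h1 t + h2 t))%E).
  apply: nonneg_le_integral => t; first by move=> _; exact: outer_measure_ge0.
  rewrite /= in_itv/= andbT => t0; have [tT|Tt] := leP t T.
    apply: (@le_trans _ _ (h1 t)); last by rewrite leeDl.
    rewrite /h1 patchE mem_set/=; last by rewrite in_itv/= t0.
    apply: le_trans (hausdorff_content_cube_le _ _).
    by apply: le_outer_measure => x [].
  apply: (@le_trans _ _ (h2 t)); last by rewrite leeDr.
  rewrite /h2 patchE mem_set/=; last by rewrite in_itv/= ltW.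
  have r0 : 0 < t `^ (- a^-1) by rewrite powR_gt0.
  apply: (@le_trans _ _ (H n%:R (cube_set (centered_cube (PosNum r0))))).
    apply: le_outer_measure => x [_ /= tx]; apply: norm_lt_centered_cube.
    exact: power_weight_gt_norm.
  apply: le_trans (hausdorff_content_cube_le _ _) _.
  rewrite -EFinM lee_fin edge_centered_cube/= powRM ?(ltW r0)// -powRrM mulNr.
  by rewrite mulrC [a^-1 * _]mulrC sE1 mulrC.
rewrite ge0_integralD//=; last 2 first.
- by apply/measurable_restrict => //; exact: measurable_cst.
- apply/measurable_restrict => //; apply: measurable_funeM; exact: measurable_funTS.
rewrite -!integral_mkcondr.
have -> : `]0, +oo[%classic `&` `]0, T]%classic = `]0, T]%classic :> set R.
  by apply/setIidPr => t /=; rewrite !in_itv/= andbT => /andP[].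
have -> : `]0, +oo[%classic `&` `[T, +oo[%classic = `[T, +oo[%classic :> set R.
  by apply/setIidPr => t /=; rewrite !in_itv/= !andbT; exact: lt_le_trans.
rewrite integral_cst//= lebesgue_measure_itv/= lte_fin T0 oppr0 adde0.
rewrite ge0_integralZl_EFin//; last 2 first.
- by move=> t _; rewrite lee_fin powR_ge0.
- exact: measurable_funTS.
rewrite integral_powR_tail// -!EFinM -EFinD lee_fin.
rewrite mulrDl mul1r /T -edge_powRD -powRrM mulrNN sE.
by rewrite mulrA.
Qed.

(** With m = |Q.1| + l, a bound for the norm on Q, the infimum of
    the weight on Q is at least m^-a.  If m <= 4 l then Q is close to the
    origin and the average is of order l^-a; otherwise the norm is at least
    m / 2 on Q and the weight at most (m / 2)^-a. *)
Lemma power_weight_infimum (a : R) : 0 < a < n%:R ->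
  exists2 K : R, 0 < K & forall Q, exists c : R, [/\ 0 < c,
    forall x, cube_set Q x -> (c%:E <= power_weight a x)%E &
    (capacitary_average n%:R Q (power_weight a) <= (K * c)%:E)%E].
Proof.
move=> an; have /andP[a0 an'] := an.
pose C := 1 + 2 `^ n%:R / (n%:R / a - 1).
have C0 : 0 < C.
  by rewrite ltr_pwDl// divr_ge0 ?powR_ge0// subr_ge0 ler_pdivlMr// mul1r ltW.
exists (2 `^ a + C * 4 `^ a) => [|Q].
  by rewrite addr_gt0 ?mulr_gt0 ?powR_gt0.
have nn : 0 <= (n%:R : R) <= n%:R by rewrite ler0n lexx.
pose m := `|Q.1| + edge Q.
have m0 : 0 < m by rewrite ltr_wpDl ?normr_ge0 ?edge_gt0.
exists (m `^ (- a)); split; first by rewrite powR_gt0.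
  move=> x Qx; apply: power_weight_lower => //; first exact: ltW.
  exact: cube_norm_upper.
have [mQ|Qm] := leP m (4 * edge Q).
  rewrite capacitary_averageE//.
  apply: (@le_trans _ _ ((C * edge Q `^ (n%:R - a))%:E * (edge Q `^ (- n%:R))%:E)%E).
    apply: lee_wpmul2r; first by rewrite lee_fin powR_ge0.
    exact: choquet_power_weight_le.
  rewrite -EFinM lee_fin -mulrA -edge_powRD addrAC subrr sub0r.
  apply: (@le_trans _ _ (C * 4 `^ a * m `^ (- a))); last first.
    by rewrite ler_wpM2r ?powR_ge0// lerDr powR_ge0.
  rewrite -mulrA ler_wpM2l ?(ltW C0)//.
  rewrite !powRN ler_pdivlMr ?powR_gt0// mulrC ler_pdivrMr ?powR_gt0//.
  by rewrite -powRM// ge0_ler_powR ?nnegrE ?(ltW a0) ?(ltW m0) ?mulr_ge0 ?ler0n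
    ?edge_ge0.
apply: (@le_trans _ _ (2 `^ a * m `^ (- a))%:E); last first.
  by rewrite lee_fin ler_wpM2r ?powR_ge0// lerDl mulr_ge0 ?powR_ge0 ?(ltW C0).
have m20 : 0 < m / 2 by rewrite divr_gt0.
have -> : 2 `^ a * m `^ (- a) = (m / 2) `^ (- a).
  rewrite powRM ?(ltW m0)//.
  by rewrite mulrC -[in RHS]powR_inv1// -powRrM mulN1r opprK.
apply: capacitary_average_le_bound => //; first exact: powR_ge0.
move=> x Qx; apply: power_weight_upper; [exact: ltW|exact: m20|].
apply: le_trans (cube_norm_lower Qx); move: Qm; rewrite /m; lra.
Qed.

Lemma hausdorff_content_origin : (0 < n)%N -> H n%:R [set 0] = 0%E.
Proof.
move=> n0; apply/eqP; rewrite eq_le outer_measure_ge0 andbT.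
apply/lee_addgt0Pr => e e0; rewrite add0e.
pose r := Num.min 1 e / 2.
have r0 : 0 < r by rewrite divr_gt0// lt_min ltr01.
apply: (@le_trans _ _ (H n%:R (cube_set (centered_cube (PosNum r0))))).
  by apply: le_outer_measure => _ ->; apply: norm_lt_centered_cube; rewrite normr0.
apply: le_trans (hausdorff_content_cube_le _ _) _; rewrite lee_fin.
have -> : edge (centered_cube (PosNum r0) : cube R n) = Num.min 1 e.
  by rewrite edge_centered_cube/= /r mulrC divfK.
have r1 : 0 < Num.min 1 e <= 1 by rewrite lt_min ltr01 e0 ge_min lexx.
apply: (@le_trans _ _ (Num.min 1 e)); last by rewrite ge_min lexx orbT.
by apply: ge1r_powR; rewrite // ler1n.
Qed.

Lemma power_weight_Ap (a p : R) : 0 < a < n%:R -> 1 <= p ->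
  @capacitary_Ap R n n%:R p (power_weight a).
Proof.
move=> an p1; have /andP[a0 an'] := an.
have n0 : (0 < n)%N by rewrite -(ltr0n R) (lt_trans a0).
have [K K0 wK] := power_weight_infimum an.
have nn : 0 <= (n%:R : R) <= n%:R by rewrite ler0n lexx.
apply: (capacitary_Ap_of_infimum nn p1 K0 _ wK); split.
- exact: power_weight_ge0.
- apply/choquet_integral_compactP => Q.
  by apply: le_lt_trans (choquet_power_weight_le Q an) _; exact: ltry.
exists [set 0]; first exact: hausdorff_content_origin.
move=> x /eqP x0; rewrite /power_weight inver.
have wx0 : 0 < `|x| `^ a by rewrite powR_gt0 ?normr_gt0.
by rewrite gt_eqF// lte_fin invr_gt0 wx0 ltry.
Qed.

(** On the cube of edge 2 r around the origin the weight is at least r^-a, so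
    by Markov's inequality its integral over the unit cube is at least a
    constant times r^(d - a), for every r in ]0, 1]. *)
Lemma power_weight_notin_Ap (d a p : R) : 0 < d < a -> a < n%:R ->
  ~ @capacitary_Ap R n d p (power_weight a).
Proof.
move=> /andP[d0 da] an [[_ /choquet_integral_compactP wfin _] _].
have a0 : 0 < a := lt_trans d0 da.
set Q : cube R n := centered_cube 1%:pos.
have := wfin Q; rewrite -ge0_fin_numE ?choquet_integral_ge0// => Cfin.
set C := fine (choquet_integral d (cube_set Q) (power_weight a)).
have lower (r : R) : 0 < r <= 1 -> 2 `^ d / 2 * r `^ (d - a) <= C.
  move=> /andP[r0 r1].
  have t0 : 0 < r `^ (- a) / 2 by rewrite divr_gt0// powR_gt0.
  rewrite -lee_fin fineK//; apply: le_trans (markov_choquet _ _ _ t0).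
  apply: (@le_trans _ _ ((r `^ (- a) / 2)%:E *
      H d (cube_set (centered_cube (PosNum r0))))%E).
    rewrite hausdorff_content_cube ?(ltW d0) ?(ltW (lt_trans da an))//.
    rewrite -EFinM lee_fin edge_centered_cube/= powRM ?(ltW r0)//.
    rewrite powRD; last by apply/implyP => _; rewrite gt_eqF.
    by rewrite le_eqVlt; apply/orP; left; apply/eqP; ring.
  apply: lee_wpmul2l; first by rewrite lee_fin ltW.
  apply: le_outer_measure => x xr; have := centered_cube_norm_le xr => /= xr'.
  split.
    move=> i; have := xr i; rewrite /Q /centered_cube /edge/= !mxE.
    move=> /andP[x1 x2]; apply/andP; split.
      by apply: le_lt_trans x1; rewrite lerN2.
    by apply: le_trans x2 _; rewrite !mulr2n; lra.
  apply: lt_le_trans (power_weight_lower (ltW a0) r0 xr').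
  by rewrite lte_fin ltr_pdivrMr// ltr_pMr ?powR_gt0// ltr1n.
(* A radius for which the lower bound exceeds C. *)
pose c := 2 `^ d / 2 : R; have c0 : 0 < c by rewrite divr_gt0// powR_gt0.
pose y := 1 + `|C| / c; have y1 : 1 <= y by rewrite lerDl divr_ge0// ltW.
have y0 : 0 < y := lt_le_trans ltr01 y1.
have := lower (y `^ (d - a)^-1).
have e0 : (d - a)^-1 <= 0 by rewrite invr_le0 subr_le0 ltW.
rewrite powR_gt0// -[X in _ <= X -> _](powRr0 y) ler_powR// => /(_ isT).
rewrite -powRrM mulVf ?subr_eq0 ?lt_eqF// powRr1 ?(ltW y0)// leNgt => /negP; apply.
rewrite -/c /y mulrDr mulr1 mulrC divfK ?gt_eqF//.
by apply: le_lt_trans (ler_norm C) _; rewrite ltrDr.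
Qed.

End power_weight_Ap.

Unset Implicit Arguments.

Theorem corollary2p19 (R : realType) (n : nat) (delta p : R)
    (hdelta : 0 < delta < n%:R) (hp : 1 <= p) :
  @capacitary_Ap R n delta p `<` @capacitary_Ap R n n%:R p /\
  (forall w : 'rV[R]_n -> \bar R, lebesgue_measurable w ->
     (capacitary_Ap n%:R p w <-> muckenhoupt_Ap p w)).
Proof.
have /andP[d0 dn] := hdelta; split; last first.
  by move=> w mw; exact: capacitary_Ap_lebesgue.
split; first by apply: capacitary_Ap_exponent => //; rewrite !ltW.
pose a := (delta + n%:R) / 2.
have da : delta < a by rewrite /a; lra.
have an : a < n%:R by rewrite /a; lra.
have := @power_weight_Ap R n a p; rewrite (lt_trans d0 da) an => /(_ isT hp) wn.
by move=> /(_ _ wn); apply: power_weight_notin_Ap => //; rewrite d0 da.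
Qed.
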